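(* Let $X$ be a finitely ramified fractal. Then $X$ admits an undistorted metric if and only if there exists a constant $k\in\mathbb{N}$ that satisfies the following conditions: (1) Every $n$-cell in $X$ contains at least two disjoint $(n+k)$-cells (for every $n\ge0$). (2) No two disjoint $n$-cells in $X$ intersect a common $(n+k)$-cell (for every $n\ge 0$).
   Context: A finitely ramified cell structure on a compact, connected, metrizable space $X$ consists of a locally finite rooted tree of subsets of $X$, called cells, such that: (1) every cell is compact, connected, and has nonempty interior; (2) the root is the whole space $X$, and each cell is the union of its children; (3) the intersection of any two distinct cells at the same level is a finite set; (4) for every infinite descending path $X=E_0\supseteq E_1\supseteq\cdots$ in the tree, $\bigcap_n E_n$ is a single point. Cells at level $n$ are called $n$-cells (the root being at level $0$). The same subset may occur at several levels; formally a cell is a pair $(E,n)$. A finitely ramified fractal is a metrizable space with a finitely ramified cell structure. Metrics on $X$ are understood to induce the topology of $X$. A metric $d$ on $X$ is undistorted if: (Exponential Decay) there are constants $0<r\le R<1$ and $C\ge1$ such that $\frac{r^{n-m}}{C}\le\frac{\operatorname{diam}(E')}{\operatorname{diam}(E)}\le CR^{n-m}$ for every $m$-cell $E$ and $n$-cell $E'$ with $n\ge m$ and $E\cap E'\neq\emptyset$; and (Cell Separation) there is $\delta>0$ such that $d(E_1,E_2)\ge\delta\operatorname{diam}(E_1)$ for every pair $E_1,E_2$ of disjoint $n$-cells (same $n$), where $d(E_1,E_2)=\inf\{d(x,y):x\in E_1,y\in E_2\}$. *)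

(* Defs.v *)
From HB Require Import structures.
From mathcomp Require Import all_boot all_order all_algebra.
From mathcomp Require Import boolp classical_sets cardinality reals topology.

Set Implicit Arguments.
Unset Strict Implicit.
Unset Printing Implicit Defensive.

Import Order.TTheory GRing.Theory Num.Theory.
Local Open Scope classical_set_scope.
Local Open Scope ring_scope.

(* Metrics are plain functions, because the statement quantifies over all the
   metrics that induce one fixed topology; the first four fields are those of
   the factory [isMetric]. *)
Record compatible_metric (R : realType) (X : topologicalType)
    (d : X -> X -> R) : Prop := CompatibleMetric {
  metric_refl : forall x, d x x = 0;
  metric_eq : forall x y, d x y = 0 -> x = y;
  metric_symm : forall x y, d x y = d y x;
  metric_tri : forall y x z, d x z <= d x y + d y z;
  metric_nbhs : forall x, nbhs x = nbhs_ball_ (fun u e => [set y | d u y < e]) x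
}.

Lemma mdist_compatible (R : realType) (X : metricType R) :
  compatible_metric (@mdist R X).
Proof.
split; [exact: mdistxx | exact: mdist_positivity | exact: metric_sym | |].
- by move=> y x z; exact: metric_triangle.
- by move=> x; rewrite -metricType_numDomainType.nbhs_nbhs_mdist.
Qed.

Definition metrizable (R : realType) (X : topologicalType) : Prop :=
  exists d : X -> X -> R, compatible_metric d.

(* The cell (E, n) is encoded by [cell n E], so the same subset may be a cell
   at several levels; the vertices of the tree at depth n are the n-cells, and
   [child n E E'] says that (E', n.+1) is a child of (E, n). *)
Record cell_structure (X : topologicalType) : Type := CellStructure {
  cell : nat -> set (set X);
  child : nat -> set X -> set X -> Prop;
  cell_root : cell 0%N = [set [set: X]];
  child_cell : forall n E E', child n E E' -> cell n E /\ cell n.+1 E';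
  cell_parent : forall n E', cell n.+1 E' -> exists! E, child n E E';
  children_finite : forall n E, cell n E -> finite_set [set E' | child n E E'];
  cell_compact : forall n E, cell n E -> compact E;
  cell_connected : forall n E, cell n E -> connected E;
  cell_interior : forall n E, cell n E -> interior E !=set0;
  cell_children : forall n E, cell n E ->
    E = \bigcup_(E' in [set E' | child n E E']) E';
  cell_meet_finite : forall n E F, cell n E -> cell n F -> E <> F ->
    finite_set (E `&` F);
  cell_path : forall p : nat -> set X, p 0%N = [set: X] ->
    (forall n, child n (p n) (p n.+1)) ->
    exists x, \bigcap_n p n = [set x]
}.

Definition diam (R : realType) (X : Type) (d : X -> X -> R) (E : set X) : R :=
  sup [set d x y | x in E & y in E].

Definition set_dist (R : realType) (X : Type) (d : X -> X -> R)
    (E F : set X) : R :=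
  inf [set d x y | x in E & y in F].

(* When X is a single point, all diameters vanish and the quotient below is
   0 / 0 = 0, so that such an X has no metric with exponential decay. *)
Definition exponential_decay (R : realType) (X : topologicalType)
    (T : cell_structure X) (d : X -> X -> R) : Prop :=
  exists r R' C : R, [/\ 0 < r, r <= R', R' < 1, 1 <= C &
    forall m n E E', (m <= n)%N -> cell T m E -> cell T n E' ->
      E `&` E' !=set0 ->
      r ^+ (n - m) / C <= diam d E' / diam d E <= C * R' ^+ (n - m)].

Definition cell_separation (R : realType) (X : topologicalType)
    (T : cell_structure X) (d : X -> X -> R) : Prop :=
  exists2 delta : R, 0 < delta &
    forall n E1 E2, cell T n E1 -> cell T n E2 -> E1 `&` E2 = set0 ->
      delta * diam d E1 <= set_dist d E1 E2.

Definition undistorted (R : realType) (X : topologicalType)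
    (T : cell_structure X) (d : X -> X -> R) : Prop :=
  [/\ compatible_metric d, exponential_decay T d & cell_separation T d].

(* Main.v *)
(* If a metric is undistorted, take k with C R^k < min(1/4, delta): an
   (n+k)-cell meeting an n-cell E is then shorter than a quarter of diam E,
   which gives (1), and shorter than the distance from E to any n-cell disjoint
   from it, which gives (2).

   Conversely, call x and y n-linked when they lie in two n-cells that meet.
   By (2), linking at level n+2k is a transitive relation up to passing to
   level n, so t^(largest n such that x, y are n-linked) is a quasi-metric.
   With t^(4k) >= 1/2, Frink's chain construction turns it into a metric d with
   d(x,y) <= t^n when x, y are n-linked, and d(x,y) >= t^(n+4k) when they are
   not. By Konig's lemma the stars {y | x, y n-linked} form a neighbourhood
   basis at x, so d induces the topology. By (1), the diameter of an n-cell is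
   t^n up to a constant factor, and d is undistorted. *)
Require Import Defs.
From HB Require Import structures.
From mathcomp Require Import all_boot all_order all_algebra.
From mathcomp Require Import boolp classical_sets cardinality reals topology.
From mathcomp Require Import sequences normedtype lra.

Set Implicit Arguments.
Unset Strict Implicit.
Unset Printing Implicit Defensive.

Import Order.TTheory GRing.Theory Num.Theory.
Import numFieldNormedType.Exports.
Local Open Scope classical_set_scope.
Local Open Scope ring_scope.

(** * Kőnig's lemma and nested compact sets *)

(** If each [a] failed at some level [f a], then at the largest of these finitely many levels no [a]
    could survive, because [P] is decreasing in the level. *)
Lemma finite_pigeonhole (A : Type) (S : set A) (P : nat -> A -> Prop) :
  finite_set S -> (forall m a, P m.+1 a -> P m a) ->
  (forall m, exists2 a, S a & P m a) -> exists2 a, S a & forall m, P m a.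
Proof.
move=> finS Pdecr PS.
have Pmono m m' a : (m <= m')%N -> P m' a -> P m a.
  by move=> /subnK <-; elim: (m' - m)%N => [//|j IH] /Pdecr.
apply: contrapT => noP.
have [f Pf] : {f : A -> nat & forall a, S a -> ~ P (f a) a}.
  apply: (choice (P := fun a m => S a -> ~ P m a)) => a.
  have [Sa|] := pselect (S a); last by exists 0%N.
  have /existsNP[m Pm] : ~ forall m, P m a by move=> Pa; apply: noP; exists a.
  by exists m.
have /finite_seqP[s fS] := finite_image f finS.
have [a Sa Pa] := PS (\max_(m <- s) m)%N.
apply: (Pf a Sa); apply: Pmono Pa.
have : (f @` S) (f a) by exists a.
by rewrite fS /= => fas; rewrite (big_rem _ fas) /= leq_maxl.
Qed.

Section Konig.
Variables (A : Type) (V : nat -> set A) (e : nat -> A -> A -> Prop).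
Hypothesis V_finite : forall n, finite_set (V n).
Hypothesis V_nonempty : forall n, V n !=set0.
Hypothesis V_parent : forall n b, V n.+1 b -> exists2 a, V n a & e n a b.

Fixpoint has_descendant (m n : nat) (a : A) : Prop :=
  V n a /\ if m is m'.+1 then exists2 b, e n a b & has_descendant m' n.+1 b
           else True.

Lemma has_descendantV m n a : has_descendant m n a -> V n a.
Proof. by case: m => [|m] []. Qed.

Lemma has_descendant_decr n m a :
  has_descendant m.+1 n a -> has_descendant m n a.
Proof.
elim: m n a => [|m IH] n a [Va [b eab db]]; first by [].
by split=> //; exists b => //; exact: IH.
Qed.

Lemma has_descendant_ex m n : exists2 a, V n a & has_descendant m n a.
Proof.
elim: m n => [|m IH] n; first by have [a Va] := V_nonempty n; exists a.
have [b Vb db] := IH n.+1.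
by have [a Va eab] := V_parent Vb; exists a => //; split=> //; exists b.
Qed.

(** A vertex with arbitrarily long descending paths has, by the pigeonhole over the next finite
    level, a successor of the same kind; choice strings these together. Parents need not be unique,
    so the lemma also applies to pairs of cells. *)
Lemma konig : exists p, forall n, V n (p n) /\ e n (p n) (p n.+1).
Proof.
pose ext n a := forall m, has_descendant m n a.
have [a0 _ ext0] : exists2 a, V 0%N a & ext 0%N a.
  apply: (finite_pigeonhole (V_finite 0) (P := fun m => has_descendant m 0)).
    exact: has_descendant_decr.
  by move=> m; exact: has_descendant_ex.
have [f fP] : {f : nat * A -> A & forall x, ext x.1 x.2 ->
    e x.1 x.2 (f x) /\ ext x.1.+1 (f x)}.
  apply: (choice (P := fun x b => ext x.1 x.2 ->
    e x.1 x.2 b /\ ext x.1.+1 b)) => -[n a] /=.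
  have [extna|] := pselect (ext n a); last by exists a.
  have [b [_ eab] extb] : exists2 b, V n.+1 b /\ e n a b & ext n.+1 b.
    apply: (finite_pigeonhole (S := [set b | V n.+1 b /\ e n a b])
      (P := fun m => has_descendant m n.+1)).
    - by apply: sub_finite_set (V_finite n.+1) => b [].
    - exact: has_descendant_decr.
    move=> m; have [_ [b eab db]] := extna m.+1.
    by exists b => //; split=> //; exact: has_descendantV db.
  by exists b.
pose p := fix p n := if n is n'.+1 then f (n', p n') else a0.
have extp n : ext n (p n) by elim: n => [//|n IH]; case: (fP (n, p n) IH).
exists p => n; split; first exact: has_descendantV (extp n 0%N).
by case: (fP (n, p n) (extp n)).
Qed.

End Konig.

(** Choose a point in each [K n]: the tail of this sequence stays in the closed set [K n], so a
    cluster point lies in all of them. *)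
Lemma compact_nested_meet (X : topologicalType) (K : nat -> set X) :
  compact [set: X] -> (forall n, closed (K n)) -> (forall n, K n !=set0) ->
  (forall n, K n.+1 `<=` K n) -> \bigcap_n K n !=set0.
Proof.
move=> cX clK K0 Kdecr.
have Kmono n m : (n <= m)%N -> K m `<=` K n.
  by move=> /subnK <-; elim: (m - n)%N => [//|j IH] x /Kdecr; exact: IH.
have [x xK] := choice K0.
have [p [_ px]] := cX (x @ \oo) _ filterT.
exists p => n _; apply: clK => B Bp; rewrite setIC.
have [y [Ky By]] : K n `&` B !=set0.
  apply: px Bp; exists n => // m /= nm; exact: Kmono (xK m).
by exists y.
Qed.

(** * Estimates on powers *)

Lemma expr_small (R : realType) (r e : R) : 0 < r < 1 -> 0 < e -> exists n, r ^+ n < e.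
Proof.
move=> /andP[r0 r1] e0.
have /cvg_expr/cvgr0_norm_lt/(_ _ e0)[n _ rn] : `|r| < 1 by rewrite gtr0_norm.
exists n; have := rn n (leqnn n).
by rewrite /= ger0_norm // exprn_ge0 // ltW.
Qed.

(** Bernoulli's inequality, from which an explicit base [t] with [t^(4k)] at least 1/2 is obtained
    without extracting roots. *)
Lemma bernoulli_le (R : realType) (u : R) n :
  0 <= u <= 1 -> 1 - n%:R * u <= (1 - u) ^+ n.
Proof.
move=> /andP[u0 u1]; elim: n => [|n IH]; first by rewrite mul0r subr0.
rewrite exprS -natr1.
have : (1 - u) * (1 - n%:R * u) <= (1 - u) * (1 - u) ^+ n.
  by rewrite ler_wpM2l //; lra.
have : 0 <= n%:R * u * u :> R by rewrite !mulr_ge0.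
nra.
Qed.

(** * Compatible metrics, diameters and distances of sets *)

Section CompatibleMetric.
Variables (R : realType) (X : topologicalType) (d : X -> X -> R).
Hypothesis dX : compatible_metric d.

Lemma metric_ge0 x y : 0 <= d x y.
Proof.
have := metric_tri dX y x x; rewrite (metric_refl dX) (metric_symm dX y x).
lra.
Qed.

Lemma compatible_nbhsP x (U : set X) :
  nbhs x U <-> exists2 e : R, 0 < e & [set y | d x y < e] `<=` U.
Proof. by rewrite (metric_nbhs dX). Qed.

Lemma compatible_hausdorff : hausdorff_space X.
Proof.
move=> p q pq; apply: contrapT => pNq.
have d0 : 0 < d p q.
  rewrite lt_neqAle metric_ge0 andbT eq_sym.
  by apply/eqP => /(metric_eq dX).
have ball x : nbhs x [set y | d x y < d p q / 2].
  by apply/compatible_nbhsP; exists (d p q / 2) => //; lra.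
have [z [/= pz qz]] := pq _ _ (ball p) (ball q).
have := metric_tri dX z p q; rewrite (metric_symm dX z q); lra.
Qed.

(** A nonzero diameter certifies boundedness, since [sup] takes the default value 0 on a set that
    has no supremum. *)
Lemma le_diam E x y : diam d E <> 0 -> E x -> E y -> d x y <= diam d E.
Proof.
move=> diam0 Ex Ey; apply: ub_le_sup; last by exists x => //; exists y.
by apply: contrapT => nub; apply: diam0; apply: sup_out => -[].
Qed.

Lemma diam_ge0 E : 0 <= diam d E.
Proof.
rewrite /diam; set D := [set d x y | x in E & y in E].
have [|/sup_out ->//] := pselect (has_sup D).
move=> [[r Er] ub]; apply: (le_trans _ (ub_le_sup ub Er)).
by case: Er => x _ [y _ <-]; exact: metric_ge0.
Qed.

Lemma diam_le E (c : R) :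
  E !=set0 -> (forall x y, E x -> E y -> d x y <= c) -> diam d E <= c.
Proof.
move=> [x Ex] dE; apply: ge_sup.
  by exists (d x x), x => //; exists x.
by move=> _ [y Ey [z Ez <-]]; exact: dE.
Qed.

Lemma set_dist_le E F x y : E x -> F y -> set_dist d E F <= d x y.
Proof.
move=> Ex Fy; apply: ge_inf; last by exists x => //; exists y.
by exists 0 => _ [u _ [v _ <-]]; exact: metric_ge0.
Qed.

End CompatibleMetric.

(** * Ancestors and descendants of cells; linked points *)

Section Cells.
Variables (X : topologicalType) (T : cell_structure X).

Lemma cell_nonempty n E : cell T n E -> E !=set0.
Proof. by move=> /cell_interior[x /interior_subset Ex]; exists x. Qed.

Lemma child_sub n E E' : child T n E E' -> E' `<=` E.
Proof.
move=> EE' x E'x; have [cE _] := child_cell EE'.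
by rewrite (cell_children cE); exists E'.
Qed.

Lemma cells_finite n : finite_set (cell T n).
Proof.
elim: n => [|n IH]; first by rewrite cell_root; exact: finite_set1.
apply: (@sub_finite_set _ _
    (\bigcup_(E in cell T n) [set E' | child T n E E'])).
  move=> E' /cell_parent[E [EE' _]].
  by exists E => //; case: (child_cell EE').
by apply: bigcup_finite => // E cE; exact: children_finite.
Qed.

Lemma cell_descend m n E x : cell T n E -> E x ->
  exists E', [/\ cell T (n + m) E', E' `<=` E & E' x].
Proof.
move=> cE Ex; elim: m => [|m [F [cF FE Fx]]].
  by exists E; rewrite addn0; split.
move: Fx; rewrite {1}(cell_children cF) => -[F' FF' F'x].
exists F'; rewrite addnS; split => //; first by case: (child_cell FF').
by move=> y /(child_sub FF') /FE.
Qed.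

Lemma cell_ancestor m n E' : cell T (n + m) E' ->
  exists2 E, cell T n E & E' `<=` E.
Proof.
elim: m E' => [|m IH] E'; first by rewrite addn0; exists E'.
rewrite addnS => /cell_parent[F [FE' _]].
have [E cE FE] := IH F (child_cell FE').1.
by exists E => // x /(child_sub FE') /FE.
Qed.

Lemma cells_cover n x : exists2 E, cell T n E & E x.
Proof.
have [|//|E [cE _ Ex]] := @cell_descend n 0%N [set: X] x.
  by rewrite cell_root.
by exists E.
Qed.

Definition linked n x y := exists E F,
  [/\ cell T n E, cell T n F, E x, F y & E `&` F !=set0].

Lemma linked_cell n E x y : cell T n E -> E x -> E y -> linked n x y.
Proof. by move=> cE Ex Ey; exists E, E; split => //; exists x. Qed.

Lemma linked_refl n x : linked n x x.
Proof. by have [E cE Ex] := cells_cover n x; exact: (linked_cell cE). Qed.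

Lemma linked_sym n x y : linked n x y -> linked n y x.
Proof.
by move=> [E [F [cE cF Ex Fy EF]]]; exists F, E; split => //; rewrite setIC.
Qed.

Lemma linked_le n m x y : (n <= m)%N -> linked m x y -> linked n x y.
Proof.
move=> /subnKC <- [E [F [cE cF Ex Fy [z [Ez Fz]]]]].
have [E' cE' EE'] := cell_ancestor cE; have [F' cF' FF'] := cell_ancestor cF.
exists E', F'; split=> //; [exact: EE'|exact: FF'|].
by exists z; split; [exact: EE'|exact: FF'].
Qed.

Lemma cell_path_meet (p : nat -> set X) :
  (forall n, child T n (p n) (p n.+1)) -> exists x, \bigcap_n p n = [set x].
Proof.
move=> pc; apply: cell_path (pc).
by have := (child_cell (pc 0%N)).1; rewrite cell_root.
Qed.

(** * Stars as a neighbourhood basis *)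

Section Stars.
Hypothesis X_hausdorff : hausdorff_space X.
Hypothesis X_compact : compact [set: X].

Lemma cell_closed n E : cell T n E -> closed E.
Proof. by move=> cE; apply: compact_closed => //; exact: cell_compact cE. Qed.

(** The finitely many [n]-cells that miss [x] have a closed union; any point outside it shares an
    [n]-cell with [x]. *)
Lemma nbhs_star n x : nbhs x (linked n x).
Proof.
pose far := \bigcup_(E in [set E | cell T n E /\ ~ E x]) E.
have clfar : closed far.
  apply: closed_bigcup => [|E [cE _]]; last exact: cell_closed cE.
  by apply: sub_finite_set (cells_finite n) => E [].
apply: (@filterS _ (nbhs x) _ (~` far)); last first.
  by apply: open_nbhs_nbhs; split; [exact: closed_openC|case=> E [_ +]].
move=> y Nfar; have [E cE Ey] := cells_cover n y.
apply: (linked_cell cE _ Ey); apply: contrapT => NEx.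
by apply: Nfar; exists E.
Qed.

(** Otherwise each level has two meeting cells, the first containing [x] and the second leaving [O].
    Kőnig's lemma arranges such pairs into two descending paths, which shrink to one common point;
    that point is [x], yet it lies outside [O]. *)
Lemma nbhs_linked_sub x U : nbhs x U -> exists n, linked n x `<=` U.
Proof.
rewrite nbhsE => -[O [openO Ox] OU].
suff [n] : exists n, linked n x `<=` O by move=> nO; exists n => y /nO /OU.
apply: contrapT => /forallNP NO.
pose V n := [set q : set X * set X | [/\ cell T n q.1, cell T n q.2, q.1 x,
  q.1 `&` q.2 !=set0 & q.2 `&` ~` O !=set0]].
pose e n (q q' : set X * set X) := child T n q.1 q'.1 /\ child T n q.2 q'.2.
have [|||p pP] := @konig _ V e.
- move=> n; apply: sub_finite_set (finite_setX (cells_finite n) (cells_finite n)).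
  by move=> q [].
- move=> n; have /existsNP[y /not_implyP[[E [F [cE cF Ex Fy EF]]] NOy]] := NO n.
  by exists (E, F); split => //; exists y.
- move=> n [E' F'] [/= /cell_parent[E [EE' _]] /cell_parent[F [FF' _]]].
  move=> E'x [z [E'z F'z]] [y [F'y NOy]].
  have sE := child_sub EE'; have sF := child_sub FF'.
  exists (E, F) => //; split => /=.
  + by case: (child_cell EE').
  + by case: (child_cell FF').
  + exact: sE.
  + by exists z; split; [exact: sE|exact: sF].
  + by exists y; split => //; exact: sF.
have Vp n := (pP n).1; have ep n := (pP n).2.
have [a pa] := cell_path_meet (fun n => (ep n).1).
have [b pb] := cell_path_meet (fun n => (ep n).2).
have cl1 n : closed (p n).1 by case: (Vp n) => /cell_closed.
have cl2 n : closed (p n).2 by case: (Vp n) => _ /cell_closed.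
have xa : x = a.
  suff : (\bigcap_n (p n).1) x by rewrite pa.
  by move=> n _; case: (Vp n).
(* The cells of each pair meet, so by compactness the limits [a] and [b] of the two paths
   coincide. *)
have [w wp] : \bigcap_n ((p n).1 `&` (p n).2) !=set0.
  apply: compact_nested_meet => // [n|n|n z [z1 z2]].
  - exact: closedI.
  - by case: (Vp n).
  - by split; [exact: (child_sub (ep n).1)|exact: (child_sub (ep n).2)].
have wa : w = a.
  suff : (\bigcap_n (p n).1) w by rewrite pa.
  by move=> n /wp[].
have wb : w = b.
  suff : (\bigcap_n (p n).2) w by rewrite pb.
  by move=> n /wp[].
(* The parts of the second path outside [O] are also nested, closed and nonempty, so [b] is outside
   [O]. *)
have [u up] : \bigcap_n ((p n).2 `&` ~` O) !=set0.
  apply: compact_nested_meet => // [n|n|n z [z1 z2]].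
  - by apply: closedI => //; exact: open_closedC.
  - by case: (Vp n).
  - by split => //; exact: (child_sub (ep n).2).
have ub : u = b.
  suff : (\bigcap_n (p n).2) u by rewrite pb.
  by move=> n /up[].
by have [_] := up 0%N I; rewrite ub -wb wa -xa.
Qed.

End Stars.

(** * Consequences of condition (2) for linked points *)

Section Separation.
Variable k : nat.
Hypothesis cell_shrink : forall n E1 E2, cell T n E1 -> cell T n E2 ->
  E1 `&` E2 = set0 ->
  ~ exists E, [/\ cell T (n + k) E, E1 `&` E !=set0 & E2 `&` E !=set0].

Lemma cells_meet n E1 E2 E x y : cell T n E1 -> cell T n E2 ->
  cell T (n + k) E -> E1 x -> E x -> E2 y -> E y -> E1 `&` E2 !=set0.
Proof.
move=> c1 c2 cE E1x Ex E2y Ey.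
apply/set0P/eqP => /(cell_shrink c1 c2); apply.
by exists E; split => //; [exists x|exists y].
Qed.

(** Condition (2) is applied twice: [E2] touches the ancestors [F1] and [F3] at level [n + k], so
    these meet; then [F3] touches the ancestors [G1] and [G4] at level [n], so these meet. *)
Lemma linked_trans n x y z :
  linked (n + k + k) x y -> linked (n + k + k) y z -> linked n x z.
Proof.
move=> [E1 [E2 [c1 c2 E1x E2y [u [E1u E2u]]]]].
move=> [E3 [E4 [c3 c4 E3y E4z [v [E3v E4v]]]]].
have [F1 cF1 s1] := cell_ancestor c1; have [F3 cF3 s3] := cell_ancestor c3.
have [F4 cF4 s4] := cell_ancestor c4.
have [w [F1w F3w]] : F1 `&` F3 !=set0.
  by apply: (cells_meet cF1 cF3 c2 _ E2u _ E2y); [exact: s1|exact: s3].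
have [G1 cG1 t1] := cell_ancestor cF1; have [G4 cG4 t4] := cell_ancestor cF4.
exists G1, G4; split => //; [exact/t1/s1|exact/t4/s4|].
by apply: (cells_meet cG1 cG4 cF3 _ F3w _ (s3 _ E3v)); [exact: t1|exact/t4/s4].
Qed.

(** The cells witnessing the link need not lie in the given [E] and [F]. Again condition (2) acts
    twice: [G] makes a descendant [E'] of [E] meet the ancestor [H'] of [H], and [H'] then makes [E]
    meet [F]. *)
Lemma linked_cells_meet n E F x y : cell T n E -> cell T n F -> E x -> F y ->
  linked (n + k + k) x y -> E `&` F !=set0.
Proof.
move=> cE cF Ex Fy [G [H [cG cH Gx Hy [w [Gw Hw]]]]].
have [E' [cE' E'E E'x]] := cell_descend k cE Ex.
have [H' cH' HH'] := cell_ancestor cH.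
have [u [E'u H'u]] : E' `&` H' !=set0.
  by apply: (cells_meet cE' cH' cG E'x Gx _ Gw); exact: HH'.
by apply: (cells_meet cE cF cH' _ H'u Fy (HH' _ Hy)); exact: E'E.
Qed.

(** * Frink's chain metric *)

Section ChainMetric.
Variables (R : realType) (t : R).
Hypothesis t0 : 0 < t.
Hypothesis t1 : t < 1.
Hypothesis t_half : 1 / 2 <= t ^+ (k + k + k + k).

(** A link at any admissible level [n] costs [t^n]; [s] is the total cost. The number [l] of links
    serves as the induction measure. *)
Inductive chain : nat -> R -> X -> X -> Prop :=
| chain_nil x : chain 0 0 x x
| chain_cons n l s x y z :
    linked n x y -> chain l s y z -> chain l.+1 (t ^+ n + s) x z.

Lemma chain_ge0 l s x y : chain l s x y -> 0 <= s.
Proof. by elim=> // *; rewrite addr_ge0 // exprn_ge0 // ltW. Qed.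

Lemma chain1 n x y : linked n x y -> chain 1 (t ^+ n) x y.
Proof. by move=> nxy; have := chain_cons nxy (chain_nil y); rewrite addr0. Qed.

Lemma chain_cat l l' s s' x y z :
  chain l s x y -> chain l' s' y z -> chain (l + l') (s + s') x z.
Proof.
move=> c c'; elim: c c' => [u|n {}l {}s u v w uv _ IH] c'; first by rewrite add0r.
by rewrite addSn -addrA; apply: chain_cons uv (IH c').
Qed.

Lemma chain_sym l s x y : chain l s x y -> chain l s y x.
Proof.
elim=> [u|n {}l {}s u v w uv _ IH]; first exact: chain_nil.
rewrite addrC -addn1; apply: chain_cat IH (chain1 _); exact: linked_sym.
Qed.

(* The link at which the partial sums of the weights first exceed [h]. *)
Lemma chain_split l s x z h : chain l s x z -> 0 <= h < s ->
  exists n y1 y2 l1 l2 s1 s2,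
    [/\ chain l1 s1 x y1, linked n y1 y2, chain l2 s2 y2 z,
        (l1 < l)%N /\ (l2 < l)%N & [/\ s1 <= h, s2 <= s - h & t ^+ n <= s]].
Proof.
move=> c; elim: c h => [u|n {}l {}s u v w uv c IH] h /andP[h0 hs].
  by move: (le_lt_trans h0 hs); rewrite ltxx.
have s0 := chain_ge0 c; have tn0 : 0 < t ^+ n by rewrite exprn_gt0.
have [htn|tnh] := ltP h (t ^+ n).
  exists n, u, v, 0%N, l, 0, s; split => //; first exact: chain_nil.
  by split=> //; lra.
have [|m [y1 [y2 [l1 [l2 [s1 [s2 [c1 y12 c2 [l1l l2l] [s1h s2h tm]]]]]]]]] :=
    IH (h - t ^+ n).
  by apply/andP; split; lra.
exists m, y1, y2, l1.+1, l2, (t ^+ n + s1), s2; split => //.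
- exact: chain_cons uv c1.
- by split=> //; exact: ltnW.
- by split; lra.
Qed.

(* Frink's metrization argument: split the chain at half of its weight. *)
Lemma chain_linked l s x z n : chain l s x z ->
  s < t ^+ (n + (k + k + k + k)) -> linked n x z.
Proof.
elim/ltn_ind: l s x z n => l IH s x z n c; move: (t_half).
set K := (k + k + k + k)%N in IH * => t_K sn.
have [s0|s0] := leP s 0.
  case: c s0 sn {IH} => [u _ _|m {}l {}s u v w _ c]; first exact: linked_refl.
  by have := chain_ge0 c; have : 0 < t ^+ m by [rewrite exprn_gt0]; lra.
have [|m [y1 [y2 [l1 [l2 [s1 [s2 [c1 y12 c2 [l1l l2l] [s1h s2h tm]]]]]]]]] :=
    chain_split (h := s / 2) c.
  by apply/andP; split; lra.
(* Since [t^K] is at least 1/2, halving the weight gains [K] levels, which is what the induction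
   hypothesis needs at level [n + K]. *)
have half : s / 2 < t ^+ (n + K + K).
  rewrite exprD; apply: (@lt_le_trans _ _ (t ^+ (n + K) * (1 / 2))); first lra.
  by rewrite ler_pM2l // exprn_gt0.
have L1 : linked (n + K) x y1 by apply: (IH _ l1l _ _ _ _ c1); lra.
have L2 : linked (n + K) y2 z by apply: (IH _ l2l _ _ _ _ c2); lra.
have nKm : (n + K <= m)%N.
  rewrite leqNgt; apply/negP => mnK.
  have : t ^+ (n + K) <= t ^+ m by rewrite ler_wiXn2l ?ltW // ltnW.
  lra.
have L := linked_le nKm y12.
(* Joining the three links takes two uses of [linked_trans], each losing [2k] levels; this is why
   [K] is [4k]. *)
rewrite /K !addnA in L1 L2 L.
apply: (linked_trans (y := y2)); first exact: linked_trans L1 L.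
by apply: linked_le L2; rewrite -!addnA !leq_add2l leq_addr.
Qed.

Definition chain_sums x y := [set s | exists l, chain l s x y].

Definition chain_dist x y : R := inf (chain_sums x y).

Lemma chain_sums_lb x y : lbound (chain_sums x y) 0.
Proof. by move=> s [l /chain_ge0]. Qed.

(** Any two points are 0-linked through the root, so the infimum is not the default value of an
    empty set. *)
Lemma chain_sums_nonempty x y : chain_sums x y !=set0.
Proof.
have c0 : cell T 0 [set: X] by rewrite cell_root.
by exists (t ^+ 0), 1%N; apply: chain1; exact: (linked_cell c0).
Qed.

Lemma chain_dist_le l s x y : chain l s x y -> chain_dist x y <= s.
Proof.
by move=> c; apply: ge_inf; [exists 0; exact: chain_sums_lb|exists l].
Qed.

Lemma chain_dist_ge0 x y : 0 <= chain_dist x y.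
Proof. by apply: lb_le_inf; [exact: chain_sums_nonempty|exact: chain_sums_lb]. Qed.

Lemma chain_dist_lt x y c : chain_dist x y < c ->
  exists l s, chain l s x y /\ s < c.
Proof.
by move=> /(inf_lt (chain_sums_nonempty x y))[s [l cs] sc]; exists l, s.
Qed.

Lemma linked_chain_dist_le n x y : linked n x y -> chain_dist x y <= t ^+ n.
Proof. by move=> /chain1; exact: chain_dist_le. Qed.

Lemma chain_dist_linked n x y :
  chain_dist x y < t ^+ (n + (k + k + k + k)) -> linked n x y.
Proof. by move=> /chain_dist_lt[l [s [c sn]]]; exact: chain_linked c sn. Qed.

Lemma chain_dist_unlinked n x y : ~ linked n x y ->
  t ^+ (n + (k + k + k + k)) <= chain_dist x y.
Proof. by rewrite leNgt => nxy; apply/negP => /chain_dist_linked. Qed.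

Lemma chain_dist_refl x : chain_dist x x = 0.
Proof.
by apply/eqP; rewrite eq_le chain_dist_ge0 (chain_dist_le (chain_nil x)).
Qed.

Lemma chain_dist_sym x y : chain_dist x y = chain_dist y x.
Proof.
congr inf; apply/seteqP.
by split=> s [l c]; exists l; exact: chain_sym.
Qed.

Lemma chain_dist_tri y x z : chain_dist x z <= chain_dist x y + chain_dist y z.
Proof.
apply/ler_addgt0Pr => e e0.
have [|l [s [c sc]]] := @chain_dist_lt x y (chain_dist x y + e / 2); first lra.
have [|l' [s' [c' sc']]] := @chain_dist_lt y z (chain_dist y z + e / 2).
  lra.
have := chain_dist_le (chain_cat c c'); lra.
Qed.

(** Small balls lie in stars and fine stars lie in balls, and stars form a neighbourhood basis.
    Points at distance 0 are linked at all levels, hence equal in a Hausdorff space. *)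
Lemma chain_dist_compatible :
  hausdorff_space X -> compact [set: X] -> compatible_metric chain_dist.
Proof.
move=> hX cX; have tn n : 0 < t ^+ n by rewrite exprn_gt0.
split; [exact: chain_dist_refl| |exact: chain_dist_sym|exact: chain_dist_tri|].
  move=> x y dxy; apply: (hX) => U W xU yW.
  have [n nU] := nbhs_linked_sub hX cX xU.
  exists y; split; last exact: nbhs_singleton.
  by apply: nU; apply: chain_dist_linked; rewrite dxy.
move=> x; apply/seteqP; split => U.
  move=> /(nbhs_linked_sub hX cX)[n nU].
  by exists (t ^+ (n + (k + k + k + k))) => //= y /chain_dist_linked /nU.
move=> [e /= e0 eU].
have [|n tne] := @expr_small R t e _ e0; first by rewrite t0.
apply: filterS (nbhs_star hX n x) => y /linked_chain_dist_le xy.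
by apply: eU; exact: le_lt_trans xy tne.
Qed.

Lemma chain_diam_le n E : cell T n E -> diam chain_dist E <= t ^+ n.
Proof.
move=> cE; apply: diam_le (cell_nonempty cE) _ => x y Ex Ey.
by apply: linked_chain_dist_le; exact: (linked_cell cE).
Qed.

(** Of the [6k] in the exponent, [2k] come from [linked_cells_meet] and [4k] from Frink's bound. *)
Lemma chain_dist_disjoint n E F x y : cell T n E -> cell T n F ->
  E `&` F = set0 -> E x -> F y ->
  t ^+ (n + (k + k + k + k + k + k)) <= chain_dist x y.
Proof.
move=> cE cF EF Ex Fy.
have -> : (n + (k + k + k + k + k + k) = n + k + k + (k + k + k + k))%N.
  by rewrite !addnA.
apply: chain_dist_unlinked => /(linked_cells_meet cE cF Ex Fy).
by rewrite EF => -[].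
Qed.

Lemma chain_diam_ge n E F1 F2 : cell T n E ->
  cell T (n + k) F1 -> cell T (n + k) F2 -> F1 `<=` E -> F2 `<=` E ->
  F1 `&` F2 = set0 ->
  t ^+ (n + (k + k + k + k + k + k + k)) <= diam chain_dist E.
Proof.
move=> cE c1 c2 s1 s2 F12.
have [x F1x] := cell_nonempty c1; have [y F2y] := cell_nonempty c2.
have := chain_dist_disjoint c1 c2 F12 F1x F2y.
rewrite !addnA => /le_trans; apply.
apply: ub_le_sup; last by exists x; [exact: s1|exists y => //; exact: s2].
(* An upper bound for the distances within [E], so that [sup] is a genuine supremum. *)
exists (t ^+ n) => _ [u Eu [v Ev <-]].
by apply: linked_chain_dist_le; exact: (linked_cell cE).
Qed.

End ChainMetric.
End Separation.
End Cells.

(** * Necessity of the two conditions *)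

Lemma undistorted_constant (R : realType) (X : topologicalType)
    (T : cell_structure X) (d : X -> X -> R) : undistorted T d ->
  exists k : nat,
    (forall n E, cell T n E ->
       exists E1 E2 : set X,
         [/\ cell T (n + k) E1, cell T (n + k) E2,
             E1 `<=` E, E2 `<=` E & E1 `&` E2 = set0]) /\
    (forall n E1 E2, cell T n E1 -> cell T n E2 -> E1 `&` E2 = set0 ->
       ~ exists E : set X,
           [/\ cell T (n + k) E, E1 `&` E !=set0 & E2 `&` E !=set0]).
Proof.
move=> [dX [r [R' [C [r0 rR R1 C1 decay]]]] [delta delta0 sep]].
(* For zero diameter the ratio of [E] to itself would be 0/0 = 0, below the positive lower bound of
   exponential decay. *)
have diam_gt0 n E : cell T n E -> 0 < diam d E.
  move=> cE; rewrite lt_neqAle (diam_ge0 dX) andbT eq_sym; apply/eqP => E0.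
  have EE : E `&` E !=set0 by rewrite setIid; exact: cell_nonempty cE.
  have /andP[+ _] := decay n n E E (leqnn n) cE cE EE.
  by rewrite E0 mul0r leNgt divr_gt0 // ?exprn_gt0 //; lra.
have diam_neq0 n E : cell T n E -> diam d E <> 0.
  by move=> /diam_gt0; lra.
(* The bound 1/4 serves condition (1), and [delta] serves condition (2). *)
pose eta := Num.min (1 / 4) delta.
have eta0 : 0 < eta by rewrite lt_min delta0; lra.
have [eta4 etad] : eta <= 1 / 4 /\ eta <= delta.
  by split; rewrite /eta ge_min lexx ?orbT.
have [||k kC] := @expr_small R R' (eta / C).
- by apply/andP; split=> //; lra.
- by rewrite divr_gt0 //; lra.
have CR : C * R' ^+ k < eta by rewrite mulrC -ltr_pdivlMr //; lra.
have shrink n E E' : cell T n E -> cell T (n + k) E' -> E `&` E' !=set0 ->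
    diam d E' < eta * diam d E.
  move=> cE cE' EE'.
  have /andP[_] := decay n (n + k)%N E E' (leq_addr _ _) cE cE' EE'.
  rewrite addKn ler_pdivrMr ?(diam_gt0 _ _ cE) // => /le_lt_trans; apply.
  by rewrite ltr_pM2r // (diam_gt0 _ _ cE).
exists k; split => [n E cE|n E1 E2 c1 c2 E12 [E [cE [x [E1x Ex]] [y [E2y Ey]]]]].
- have dE := diam_gt0 _ _ cE.
  (* Take two points more than half the diameter apart: [(n+k)]-cells around them, each shorter than
     a quarter of it, cannot share a point. *)
  have [||_ [x Ex [y Ey <-]] xy] :=
    @sup_gt R [set d x y | x in E & y in E] (diam d E / 2).
  + by have [x Ex] := cell_nonempty cE; exists (d x x), x => //; exists x.
  + by rewrite -/(diam d E); lra.
  have [E1 [c1 s1 E1x]] := cell_descend k cE Ex.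
  have [E2 [c2 s2 E2y]] := cell_descend k cE Ey.
  exists E1, E2; split=> //; apply/seteqP; split=> // z [E1z E2z].
  have E1E : E `&` E1 !=set0 by exists x.
  have E2E : E `&` E2 !=set0 by exists y.
  have := shrink _ _ _ cE c1 E1E; have := shrink _ _ _ cE c2 E2E.
  have := le_diam (diam_neq0 _ _ c1) E1x E1z.
  have := le_diam (diam_neq0 _ _ c2) E2z E2y.
  have := metric_tri dX z x y.
  have : eta * diam d E <= 1 / 4 * diam d E by rewrite ler_pM2r.
  move: xy; lra.
- have E1E : E1 `&` E !=set0 by exists x.
  have := shrink _ _ _ c1 cE E1E.
  have := le_diam (diam_neq0 _ _ cE) Ex Ey.
  have := sep _ _ _ c1 c2 E12.
  have := set_dist_le dX E1x E2y.
  have : eta * diam d E1 <= delta * diam d E1.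
    by rewrite ler_pM2r // (diam_gt0 _ _ c1).
  lra.
Qed.

(** * The equivalence, with sufficiency by the chain metric *)

Theorem theorem11 (R : realType) (X : topologicalType)
    (X_metrizable : metrizable R X)
    (X_compact : compact [set: X]) (X_connected : connected [set: X])
    (T : cell_structure X) :
  (exists d : X -> X -> R, undistorted T d) <->
  (exists k : nat,
    (forall n E, cell T n E ->
       exists E1 E2 : set X,
         [/\ cell T (n + k) E1, cell T (n + k) E2,
             E1 `<=` E, E2 `<=` E & E1 `&` E2 = set0]) /\
    (forall n E1 E2, cell T n E1 -> cell T n E2 -> E1 `&` E2 = set0 ->
       ~ exists E : set X,
           [/\ cell T (n + k) E, E1 `&` E !=set0 & E2 `&` E !=set0])).
Proof.
split=> [[d /undistorted_constant //]|[k [branch shrink]]].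
have [d0 /compatible_hausdorff hX] := X_metrizable.
pose K := (k + k + k + k)%N.
(* With this [u], [K u] is below 1/2, so Bernoulli gives [t^K] at least 1/2; the summand 2 keeps [t]
   strictly between 0 and 1 even for [K = 0]. *)
pose u : R := (2 * K%:R + 2)^-1.
pose t : R := 1 - u.
have K0 : 0 <= K%:R :> R by [].
have uK : u * (2 * K%:R + 2) = 1 by rewrite mulVf //; lra.
have u0 : 0 < u by rewrite invr_gt0; lra.
have Ku0 : 0 <= K%:R * u by rewrite mulr_ge0 // ltW.
have t0 : 0 < t by rewrite /t; lra.
have t1 : t < 1 by rewrite /t; lra.
have t_half : 1 / 2 <= t ^+ K.
  have /(bernoulli_le K) : 0 <= u <= 1 by apply/andP; split; lra.
  rewrite -/t; lra.
have tn n : 0 < t ^+ n by rewrite exprn_gt0.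
pose d := chain_dist T t.
have diam_lower n E : cell T n E ->
    t ^+ (n + (k + k + k + k + k + k + k)) <= diam d E.
  move=> cE; have [F1 [F2 [c1 c2 s1 s2 F12]]] := branch n E cE.
  exact: chain_diam_ge c1 c2 s1 s2 F12.
have diam_upper n E : cell T n E -> diam d E <= t ^+ n.
  exact: chain_diam_le.
exists d; split.
- exact: (chain_dist_compatible shrink).
- set c := (k + k + k + k + k + k + k)%N in diam_lower.
  (* The diameter of an [n]-cell lies between [t^(n+c)] and [t^n], so ratios of diameters are powers
     of [t] up to the factor [t^c] either way. *)
  exists t, t, (t ^+ c)^-1; split => //.
    by rewrite invf_ge1 // exprn_ile1 // ltW.
  move=> m n E E' mn cE cE' _.
  have lE := diam_lower _ _ cE; have uE := diam_upper _ _ cE.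
  have lE' := diam_lower _ _ cE'; have uE' := diam_upper _ _ cE'.
  have dE : 0 < diam d E by exact: lt_le_trans (tn _) lE.
  rewrite -{}(subnKC mn) in lE' uE' *.
  rewrite addKn ler_pdivlMr // ler_pdivrMr // invrK.
  apply/andP; split.
    by apply: le_trans lE'; rewrite -exprD mulrC -addnA (exprD _ m) ler_pM2r.
  apply: (le_trans uE'); rewrite exprD mulrAC ler_pM2r //.
  by rewrite mulrC ler_pdivlMr // -exprD.
(* Disjoint [n]-cells are at least [t^(n+6k)] apart, while their diameters are at most [t^n]. *)
- exists (t ^+ (k + k + k + k + k + k)) => // n E1 E2 c1 c2 E12.
  apply: lb_le_inf.
    have [x E1x] := cell_nonempty c1; have [y E2y] := cell_nonempty c2.
    by exists (d x y), x => //; exists y.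
  move=> _ [x E1x [y E2y <-]].
  apply: le_trans (chain_dist_disjoint shrink t0 t1 t_half c1 c2 E12 E1x E2y).
  by rewrite (exprD _ n) mulrC ler_pM2r // diam_upper.
Qed.
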